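(* Let $f(n,p,q)$ denote the minimum number of colors in an edge-coloring of $K_n$ such that every $p$-clique contains edges of at least $q$ distinct colors. Then, as $n \to \infty$, \[ f(n,6,6) \leq n^{1/3 + o(1)} \quad\text{and}\quad f(n,8,8) \leq n^{1/4+o(1)}. \] *)

(* Defs.v *)
From mathcomp Require Import all_boot.
From mathcomp Require Import boolp.
From Stdlib Require Import Reals.

Set Implicit Arguments.
Unset Strict Implicit.
Unset Printing Implicit Defensive.

(* An edge-colouring of K_n (vertex set 'I_n) with (at most) k colours:
   a function on ordered pairs which is symmetric on edges (x != y) and
   takes values in {0, ..., k-1} on edges; values on the diagonal
   (non-edges) are irrelevant. *)
Definition edge_coloring (n k : nat) (c : 'I_n -> 'I_n -> nat) : Prop :=
  forall x y : 'I_n, x != y -> c x y = c y x /\ c x y < k.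

Definition clique_colors (n : nat) (c : 'I_n -> 'I_n -> nat) (S : {set 'I_n})
  : seq nat :=
  undup [seq c e.1 e.2 | e <- [seq (x, y) | x <- enum S, y <- enum S]
                          & e.1 != e.2].

Definition pq_coloring (n p q : nat) (c : 'I_n -> 'I_n -> nat) : Prop :=
  forall S : {set 'I_n}, #|S| = p -> q <= size (clique_colors c S).

Definition good (n p q k : nat) : Prop :=
  exists c : 'I_n -> 'I_n -> nat, edge_coloring k c /\ pq_coloring p q c.

Lemma good_exists_bool (n p q : nat) :
  (exists k, good n p q k) -> exists k, `[< good n p q k >].
Proof. by case=> k Hk; exists k; apply/asboolP. Qed.

(* f(n,p,q): the minimum number of colours of such a colouring
   (set to 0 if no such colouring exists, which never happens in the
   cases of interest, e.g. q <= binomial p 2). *)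
Definition fnpq (n p q : nat) : nat :=
  match pselect (exists k, good n p q k) with
  | left H => ex_minn (good_exists_bool H)
  | right _ => 0
  end.

(* Main.v *)
From Stdlib Require Import Reals Lra.
From mathcomp Require Import all_boot all_algebra all_field.
From mathcomp Require Import zify boolp.
Require Import Defs.

(** The colouring is a product of two colourings [chi] and [phi].

    [chi] is a signed version of the Mubayi / Conlon-Fox-Lee-Sudakov colouring
    and uses n^o(1) colours.  Vertices are bit strings cut into a fixed number
    of blocks; the colour of an edge records the first differing bit, the two
    blocks containing it, and the signed first difference inside every block.
    Split a set S of at most 8 vertices at its first branching bit into A and B.
    If A and B have no colour in common, S inherits at least |S| - 1 colours.
    A common colour shows up between A and B at some block with the three
    values "equal", "+" and "-", and counting these extra colours gives at
    least |S|.  So if S has fewer than |S| colours then recursively S = A + B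
    with a single colour between A and B: S is a monochromatic tree.

    [phi] uses O(q) colours on F_q^D.  It is based on the symmetric form
    x_0 + y_0 + x_1 y_1 + ... + x_(D-1) y_(D-1), but is replaced by a
    coordinate sum on the pairs with form x y = form x x or form y y.  Let r(A)
    be the rank of the vectors (1, a), a in A.  If all edges between A and B
    have one colour then r(A) + r(B) <= D + 1, by orthogonality, and
    r(A + B) > max(r(A), r(B)).  Hence |S| <= 2^(r(S) - 1) for a monochromatic
    tree S, and such trees cannot have 6 vertices when D = 3, nor 8 vertices
    when D = 4. *)

Set Implicit Arguments.
Unset Strict Implicit.
Unset Printing Implicit Defensive.
Import GRing.Theory.
Delimit Scope R_scope with R.

(** * Monochromatic trees *)

Section Colours.
Variables (T C : finType) (f : T -> T -> C).

Definition colours (S : {set T}) : {set C} :=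
  [set f e.1 e.2 | e in [set e : T * T | [&& e.1 \in S, e.2 \in S & e.1 != e.2]]].

Definition cross (A B : {set T}) : {set C} :=
  [set f e.1 e.2 | e in setX A B].

Definition mono (A B : {set T}) : Prop :=
  forall a a' b b', a \in A -> a' \in A -> b \in B -> b' \in B -> f a b = f a' b'.

Inductive mono_tree : {set T} -> Prop :=
| MonoLeaf x : mono_tree [set x]
| MonoNode A B : mono_tree A -> mono_tree B -> [disjoint A & B] -> mono A B ->
    mono_tree (A :|: B).

Lemma coloursP (S : {set T}) c :
  reflect (exists x y, [/\ x \in S, y \in S, x != y & c = f x y]) (c \in colours S).
Proof.
apply: (iffP imsetP) => [[[x y]]|[x [y [xS yS xy ->]]]].
  by rewrite inE /= => /and3P[xS yS xy] ->; exists x, y.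
by exists (x, y) => //; rewrite inE /= xS yS xy.
Qed.

Lemma crossP (A B : {set T}) c :
  reflect (exists x y, [/\ x \in A, y \in B & c = f x y]) (c \in cross A B).
Proof.
apply: (iffP imsetP) => [[[x y]]|[x [y [xS yS ->]]]].
  by rewrite inE /= => /andP[xS yS] ->; exists x, y.
by exists (x, y) => //; rewrite inE /= xS yS.
Qed.

Lemma cross1_mono (A B : {set T}) : #|cross A B| <= 1 -> mono A B.
Proof.
move=> /card_le1_eqP h a a' b b' aA a'A bB b'B; apply: h; apply/crossP.
  by exists a', b'.
by exists a, b.
Qed.

Lemma mono_tree_neq0 S : mono_tree S -> exists x, x \in S.
Proof.
elim=> [x|A B _ [x xA] _ _ _ _]; first by exists x; rewrite inE.
by exists x; rewrite inE xA.
Qed.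

(** Distinctness is tested after applying [g], so colours can be told apart by an invariant such as
    a signed first difference. *)
Lemma uniq_leq_card (R : eqType) (g : C -> R) (D : {set C}) (s : seq C) :
  {subset s <= D} -> uniq (map g s) -> size s <= #|D|.
Proof.
move=> sD /map_uniq us; rewrite cardE; apply: uniq_leq_size => // x /sD.
by rewrite mem_enum.
Qed.

End Colours.

(** The cardinality hypothesis makes [h] injective on the colours of [S], so an equality of coarse
    colours lifts to the fine ones. It will be used with [h] the projection of the product colouring
    to its first factor. *)
Lemma mono_tree_refine (T C C' : finType) (f : T -> T -> C) (h : C -> C')
    (S : {set T}) :
  #|colours f S| <= #|colours (fun x y => h (f x y)) S| ->
  mono_tree (fun x y => h (f x y)) S -> mono_tree f S.
Proof.
have -> : colours (fun x y => h (f x y)) S = h @: colours f S.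
  by rewrite /colours -imset_comp.
move=> le; have /imset_injP inj : #|h @: colours f S| == #|colours f S|.
  by rewrite eqn_leq leq_imset_card le.
have mem x y : x \in S -> y \in S -> x != y -> f x y \in colours f S.
  by move=> xS yS xy; apply/coloursP; exists x, y.
move=> tS.
(* Injectivity is known only on the colours of [S], so the induction runs over the subtrees [U]
   while [S] stays fixed. *)
suff gen U : mono_tree (fun x y => h (f x y)) U -> U \subset S -> mono_tree f U.
  exact: gen tS (subxx _).
elim=> [x _|A B _ IA _ IB dAB mAB]; first exact: MonoLeaf.
rewrite subUset => /andP[sA sB]; apply: MonoNode => //; [exact: IA|exact: IB|].
have ne a b : a \in A -> b \in B -> a != b.
  by move=> aA bB; apply: contraTneq bB => <-; rewrite (disjointFr dAB).
move=> a a' b b' aA a'A bB b'B; apply: inj; last exact: mAB.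
  by apply: mem; [exact: (subsetP sA)|exact: (subsetP sB)|exact: ne].
by apply: mem; [exact: (subsetP sA)|exact: (subsetP sB)|exact: ne].
Qed.

(** * The colouring of bit strings *)

Section FirstDifference.
Variables (T : Type) (bit : T -> nat -> bool).

(** By the default of [find], the value [l] encodes agreement on the whole window of [l] bits
    starting at [o]. *)
Definition fdiff o l x y :=
  find (fun t => bit x (o + t) != bit y (o + t)) (iota 0 l).

Lemma fdiff_le o l x y : fdiff o l x y <= l.
Proof. by rewrite /fdiff -[X in _ <= X](size_iota 0) find_size. Qed.

Lemma fdiff_agree o l x y t :
  t < fdiff o l x y -> bit x (o + t) = bit y (o + t).
Proof.
move=> lt; have := before_find 0 lt.
rewrite nth_iota ?add0n; last exact: leq_trans lt (fdiff_le _ _ _ _).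
by move/negbFE/eqP.
Qed.

Lemma fdiff_neq o l x y :
  fdiff o l x y < l -> bit x (o + fdiff o l x y) != bit y (o + fdiff o l x y).
Proof.
move=> lt; have := lt; rewrite -[X in _ < X](size_iota 0) -has_find.
by move/(nth_find 0); rewrite nth_iota.
Qed.

Lemma fdiffE o l x y t : t < l -> (forall t', t' < t -> bit x (o + t') = bit y (o + t')) ->
  bit x (o + t) != bit y (o + t) -> fdiff o l x y = t.
Proof.
move=> tl agree ne; case: (ltngtP (fdiff o l x y) t) => // h.
  have /fdiff_neq : fdiff o l x y < l by exact: ltn_trans tl.
  by rewrite agree // eqxx.
by rewrite (fdiff_agree h) eqxx in ne.
Qed.

Lemma fdiffC o l x y : fdiff o l x y = fdiff o l y x.
Proof. by apply: eq_find => t; rewrite eq_sym. Qed.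

Lemma eq_fdiff o l x y x' y' :
  (forall t, t < l -> bit x (o + t) = bit x' (o + t)) ->
  (forall t, t < l -> bit y (o + t) = bit y' (o + t)) ->
  fdiff o l x y = fdiff o l x' y'.
Proof.
move=> ex ey; apply: eq_in_find => t; rewrite mem_iota add0n => tl.
by rewrite ex ?ey.
Qed.

Lemma fdiff_eq o l x y : (forall t, t < l -> bit x (o + t) = bit y (o + t)) ->
  fdiff o l x y = l.
Proof.
move=> e; apply/eqP; rewrite eqn_leq fdiff_le leqNgt; apply/negP => h.
by have := fdiff_neq h; rewrite e // eqxx.
Qed.

End FirstDifference.

Ltac card_lia :=
  repeat match goal with
  | H : is_true (in_mem _ _) |- _ => clear H
  | H : _ \/ _ |- _ => clear H
  end; lia.

Section TrieColouring.
Variables (T : finType) (bit : T -> nat -> bool) (b m : nat).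

Definition pos := fdiff bit 0 (b * m).

Definition block_diff j x y := fdiff bit (j * m) m x y.

(** The guard forces [false] on equal blocks. Hence [signed_diff] is [(m, false)] for equality, and
    [(e, true)] or [(e, false)] for a first difference at offset [e]. *)
Definition block_sign j x y :=
  (block_diff j x y < m) && bit x (j * m + block_diff j x y).

Definition signed_diff j x y := (block_diff j x y, block_sign j x y).

Definition block j x := [ffun t : 'I_m => bit x (j * m + t)].

Definition trie_colour :=
  ('I_(b * m).+1 * {ffun 'I_m -> bool} * {ffun 'I_m -> bool}
   * {ffun 'I_b -> 'I_m.+1 * bool})%type.

Definition chi_lt x y : trie_colour :=
  (inord (pos x y), block (pos x y %/ m) x, block (pos x y %/ m) y,
   [ffun j : 'I_b => (inord (block_diff j x y), block_sign j x y)]).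

(** Starting the edge at the endpoint with bit 0 makes the colour symmetric without losing the
    signs. *)
Definition chi x y := if bit x (pos x y) then chi_lt y x else chi_lt x y.

Definition colour_diff (j : 'I_b) (c : trie_colour) : nat * bool :=
  (val (c.2 j).1, (c.2 j).2).

Hypothesis pos_lt : forall x y, x != y -> pos x y < b * m.

Lemma posC x y : pos x y = pos y x. Proof. exact: fdiffC. Qed.

Lemma bit_pos x y : x != y -> bit y (pos x y) = ~~ bit x (pos x y).
Proof.
move=> /pos_lt lt; have := fdiff_neq lt; rewrite add0n -/(pos x y).
by case: (bit x _) (bit y _) => [] [].
Qed.

Lemma chiC x y : x != y -> chi x y = chi y x.
Proof. by move=> xy; rewrite /chi (posC y x) (bit_pos xy); case: (bit x _). Qed.

Lemma chi_ltE x y : ~~ bit x (pos x y) -> chi x y = chi_lt x y.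
Proof. by rewrite /chi => /negbTE ->. Qed.

Lemma colour_diff_lt j x y : colour_diff j (chi_lt x y) = signed_diff j x y.
Proof. by rewrite /colour_diff /= ffunE /= inordK // ltnS fdiff_le. Qed.

Lemma pos_chi_lt x y : val (chi_lt x y).1.1.1 = pos x y.
Proof. by rewrite /= inordK // ltnS fdiff_le. Qed.

Lemma pos_chi x y : val (chi x y).1.1.1 = pos x y.
Proof. by rewrite /chi; case: ifP => _; rewrite pos_chi_lt // posC. Qed.

Lemma chi_pos x y z w : chi x y = chi z w -> pos x y = pos z w.
Proof. by rewrite -!pos_chi => ->. Qed.

Lemma block_diffC j x y : block_diff j x y = block_diff j y x.
Proof. exact: fdiffC. Qed.

Lemma block_diff_chi (j : 'I_b) x y : (colour_diff j (chi x y)).1 = block_diff j x y.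
Proof.
by rewrite /chi; case: ifP => _; rewrite colour_diff_lt //= block_diffC.
Qed.

Lemma block_bit j x y t : block j x = block j y -> t < m ->
  bit x (j * m + t) = bit y (j * m + t).
Proof. by move=> /ffunP e tm; have := e (Ordinal tm); rewrite !ffunE. Qed.

Lemma chi_ends x y z w : chi x y = chi z w ->
  let j := pos x y %/ m in
     block j x = block j z /\ block j y = block j w
  \/ block j x = block j w /\ block j y = block j z.
Proof.
move=> e; have p := chi_pos e; move: e => /=; rewrite p.
by rewrite /chi; do 2!case: ifP => _;
  rewrite /chi_lt ?(posC y x) ?(posC w z) p; case=> -> -> _; auto.
Qed.

Lemma pos_block_lt x y : x != y -> pos x y %/ m < b /\ pos x y %% m < m.
Proof.
move=> /pos_lt h; have m0 : 0 < m by case: (m) h; rewrite ?muln0.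
by rewrite ltn_divLR // ltn_mod.
Qed.

Lemma block_diff_pos x y : x != y -> block_diff (pos x y %/ m) x y = pos x y %% m.
Proof.
move=> xy; have [_ em] := pos_block_lt xy; apply: fdiffE => // [t te|].
  rewrite -[_ + t]add0n; apply: (@fdiff_agree _ _ _ (b * m)).
  by rewrite -/(pos x y) [X in _ < X](divn_eq _ m) ltn_add2l.
by rewrite -divn_eq (bit_pos xy); case: (bit x _).
Qed.

Lemma bit_before_pos x y j t : j < pos x y %/ m -> t < m ->
  bit x (j * m + t) = bit y (j * m + t).
Proof.
move=> jp tm; rewrite -[_ + t]add0n; apply: (@fdiff_agree _ _ _ (b * m)).
rewrite -/(pos x y) [X in _ < X](divn_eq _ m).
apply: leq_trans (leq_addr _ _); apply: leq_trans (_ : j.+1 * m <= _).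
  by rewrite mulSn addnC ltn_add2r.
by rewrite leq_mul2r jp orbT.
Qed.

Lemma eq_signed_diff j x y x' y' :
  (forall t, t < m -> bit x (j * m + t) = bit x' (j * m + t)) ->
  (forall t, t < m -> bit y (j * m + t) = bit y' (j * m + t)) ->
  signed_diff j x y = signed_diff j x' y'.
Proof.
move=> ex ey; have e : block_diff j x y = block_diff j x' y' by exact: eq_fdiff.
rewrite /signed_diff /block_sign e; congr (_, _).
by case: ltnP => //= h; rewrite ex.
Qed.

Record trie_split (S A B : {set T}) (s : nat) : Prop := TrieSplit {
  split_union : S = A :|: B;
  split_left : exists x, x \in A;
  split_right : exists x, x \in B;
  split_bit_left : forall x, x \in A -> ~~ bit x s;
  split_bit_right : forall x, x \in B -> bit x s;
  split_cross : forall x y, x \in A -> y \in B -> pos x y = s;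
  split_inner_left : forall x y, x \in A -> y \in A -> x != y -> s < pos x y;
  split_inner_right : forall x y, x \in B -> y \in B -> x != y -> s < pos x y }.

Lemma trie_split_exists (S : {set T}) : 1 < #|S| -> exists A B s, trie_split S A B s.
Proof.
move=> /card_gt1P[x0 [y0 [x0S y0S xy0]]].
pose P (p : T * T) := [&& p.1 \in S, p.2 \in S & p.1 != p.2].
have P0 : P (x0, y0) by rewrite /P x0S y0S.
(* A pair with the earliest first difference provides the branching bit [s]. *)
case: (arg_minnP (fun p => pos p.1 p.2) P0) => -[x y] /= /and3P[/= xS yS xy] le.
set s := pos x y in le *.
have bxy := bit_pos xy; rewrite -/s in bxy.
have min u v : u \in S -> v \in S -> u != v -> s <= pos u v.
  by move=> uS vS uv; apply: (le (u, v)); apply/and3P.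
have sl : s < b * m by exact: pos_lt.
have eqbit u v : u \in S -> v \in S -> u != v -> bit u s = bit v s -> s < pos u v.
  move=> uS vS uv e; rewrite ltn_neqAle min // andbT; apply/eqP => es.
  by have := bit_pos uv; rewrite -es e; case: (bit v s).
exists [set u in S | ~~ bit u s], [set u in S | bit u s], s; split.
- by apply/setP=> u; rewrite !inE; case: (u \in S); case: (bit u s).
- by case bx: (bit x s); [exists y | exists x]; rewrite inE ?xS ?yS ?bxy ?bx.
- by case bx: (bit x s); [exists x | exists y]; rewrite inE ?xS ?yS ?bxy ?bx.
- by move=> u; rewrite inE => /andP[].
- by move=> u; rewrite inE => /andP[].
- move=> u v; rewrite !inE => /andP[uS /negbTE bu] /andP[vS bv].
  have uv : u != v by apply: contraTneq bv => <-; rewrite bu.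
  apply/eqP; rewrite eqn_leq min // andbT leqNgt; apply/negP => lt.
  by have := fdiff_agree lt; rewrite add0n bu bv.
- move=> u v; rewrite !inE => /andP[uS /negbTE bu] /andP[vS /negbTE bv] uv.
  by apply: eqbit; rewrite // bu bv.
- move=> u v; rewrite !inE => /andP[uS bu] /andP[vS bv] uv.
  by apply: eqbit; rewrite // bu bv.
Qed.

Lemma colours_lt (S : {set T}) c : c \in colours chi S ->
  exists x y, [/\ x \in S, y \in S, x != y, ~~ bit x (pos x y) & c = chi_lt x y].
Proof.
move=> /coloursP[x [y [xS yS xy ->]]]; rewrite /chi; case: ifP => bx.
  by exists y, x; split; rewrite // 1?eq_sym // posC bit_pos // bx.
by exists x, y; split; rewrite ?bx.
Qed.

(** * Colours between the two sides of a split *)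

Section Split.
Variables (S A B : {set T}) (s : nat) (sAB : trie_split S A B s).

Lemma split_neq x y : x \in A -> y \in B -> x != y.
Proof.
move=> xA yB; apply: contraTneq (split_bit_right sAB yB) => <-.
exact: (split_bit_left sAB xA).
Qed.

Lemma split_disjoint : [disjoint A & B].
Proof.
apply/pred0P => x /=; apply/negP => /andP[xA xB].
by have := split_neq xA xB; rewrite eqxx.
Qed.

Lemma split_card : #|S| = #|A| + #|B|.
Proof.
by rewrite (split_union sAB) cardsU (disjoint_setI0 split_disjoint) cards0 subn0.
Qed.

Lemma split_chi x y : x \in A -> y \in B -> chi x y = chi_lt x y.
Proof.
move=> xA yB; apply: chi_ltE; rewrite (split_cross sAB xA yB).
exact: (split_bit_left sAB xA).
Qed.

(** The position stored in a colour is [s] on cross edges and larger inside the sides, so no cross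
    colour occurs inside. *)
Lemma split_colours :
  #|colours chi S| = #|colours chi A :|: colours chi B| + #|cross chi A B|.
Proof.
have -> : colours chi S = (colours chi A :|: colours chi B) :|: cross chi A B.
  apply/setP=> c; rewrite !inE; apply/idP/idP; last first.
    move=> h; apply/coloursP; rewrite (split_union sAB).
    case/orP: h => [/orP[]/coloursP[x [y [xS yS xy ->]]]|/crossP[x [y [xS yS ->]]]];
      exists x, y; rewrite !inE xS yS ?orbT //; split=> //; exact: split_neq.
  move=> /coloursP[x [y [xS yS xy ->]]].
  move: xS yS; rewrite (split_union sAB) !inE => /orP[]xS /orP[]yS.
  - by apply/orP; left; apply/orP; left; apply/coloursP; exists x, y.
  - by apply/orP; right; apply/crossP; exists x, y.
  - by apply/orP; right; apply/crossP; exists y, x; rewrite chiC.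
  - by apply/orP; left; apply/orP; right; apply/coloursP; exists x, y.
rewrite cardsU; set I := _ :&: _; suff -> : I = set0 by rewrite cards0 subn0.
apply/setP=> c; rewrite !inE; apply/negP => /andP[h /crossP[x [y [xA yB ec]]]].
have pc : val c.1.1.1 = s by rewrite ec pos_chi (split_cross sAB xA yB).
case/orP: h => /coloursP[u [v [uS vS uv e]]]; move: pc; rewrite e pos_chi.
  by move=> p; have := split_inner_left sAB uS vS uv; rewrite p ltnn.
by move=> p; have := split_inner_right sAB uS vS uv; rewrite p ltnn.
Qed.

(** The trace left between [A] and [B] by a common colour with first difference at offset [e] of
    block [j]. The last clause, on earlier blocks, allows witnesses at two different blocks to be
    combined. *)
Definition cross_witness j e :=
  exists x x' y y', [/\ [/\ x \in A, x' \in A, y \in B & y' \in B],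
    [/\ signed_diff j x y = (m, false), signed_diff j x y' = (e, false)
      & signed_diff j x' y = (e, true)]
    & forall j', j' < j -> signed_diff j' x y' = signed_diff j' x y
                       /\ signed_diff j' x' y = signed_diff j' x y].

(** If the oriented edges from [x] to [x'] and from [y] to [y'] share a colour, then in block [j]
    the vertex [y] is a copy of [x] and [y'] a copy of [x']. In earlier blocks [x] agrees with [x'],
    and [y] with [y']. *)
Lemma common_colour c : c \in colours chi A -> c \in colours chi B ->
  exists j e, [/\ j < b, e < m, val c.1.1.1 = j * m + e & cross_witness j e].
Proof.
move=> /colours_lt[x [x' [xA x'A xx' bx ->]]] /colours_lt[y [y' [yB y'B yy' _ E]]].
have p : pos x x' = pos y y' by rewrite -!pos_chi_lt E.
set j := pos x x' %/ m; set e := pos x x' %% m.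
have [jb em] := pos_block_lt xx'.
have pje : pos x x' = j * m + e by exact: divn_eq.
have [bxy bx'y'] : block j x = block j y /\ block j x' = block j y'.
  by case: E => _; rewrite -p -/j.
have de : block_diff j x x' = e by exact: block_diff_pos.
exists j, e; split; rewrite ?pos_chi_lt //.
exists x, x', y, y'; split=> //; first split.
- rewrite /signed_diff /block_sign.
  have -> : block_diff j x y = m by apply: fdiff_eq => t; exact: block_bit.
  by rewrite ltnn.
- rewrite -(@eq_signed_diff j x x' x y') //; last by move=> t; exact: block_bit.
  by rewrite /signed_diff /block_sign de -pje (negbTE bx) andbF.
- rewrite -(@eq_signed_diff j x' x x' y) //; last by move=> t; exact: block_bit.
  rewrite /signed_diff /block_sign block_diffC de em -pje.
  by rewrite (bit_pos xx') bx.
move=> j' lt; split; apply: eq_signed_diff => // t tm.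
  by rewrite (@bit_before_pos y y') // -p.
by rewrite (@bit_before_pos x x').
Qed.

Lemma colour_diff_cross (j : 'I_b) x y : x \in A -> y \in B ->
  colour_diff j (chi x y) = signed_diff j x y.
Proof. by move=> xA yB; rewrite split_chi // colour_diff_lt. Qed.

Lemma cross_ge3 c : c \in colours chi A -> c \in colours chi B ->
  2 < #|cross chi A B|.
Proof.
move=> cA cB.
have [j [e [jb em _ [x [x' [y [y' [[xA x'A yB y'B] [d1 d2 d3] _]]]]]]]] :=
  common_colour cA cB.
apply: (@uniq_leq_card _ _ (colour_diff (Ordinal jb)) _
          [:: chi x y; chi x y'; chi x' y]).
  by move=> z; rewrite !inE => /or3P[]/eqP->; apply/crossP;
     [exists x, y|exists x, y'|exists x', y].
by rewrite /= !colour_diff_cross // d1 d2 d3 /= !inE !xpair_eqE !(gtn_eqF em) !eqxx.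
Qed.

(** Both witnesses share the value for equality, and each adds two signed values at its own offset:
    1 + 2 + 2. *)
Lemma cross_ge5_same j e e' : j < b -> e < m -> e' < m -> e <> e' ->
  cross_witness j e -> cross_witness j e' -> 4 < #|cross chi A B|.
Proof.
move=> jb em em' ee' [x [x' [y [y' [[xA x'A yB y'B] [d1 d2 d3] _]]]]].
move=> [u [u' [v [v' [[uA u'A vB v'B] [_ d5 d6] _]]]]].
apply: (@uniq_leq_card _ _ (colour_diff (Ordinal jb)) _
          [:: chi x y; chi x y'; chi x' y; chi u v'; chi u' v]).
  move=> z; rewrite !inE => h; apply/crossP.
  by case/or4P: h => [||| /orP[]] /eqP->;
     [exists x, y|exists x, y'|exists x', y|exists u, v'|exists u', v].
rewrite /= !colour_diff_cross // d1 d2 d3 d5 d6 /= !inE !xpair_eqE.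
by rewrite !(gtn_eqF em) !(gtn_eqF em') !eqxx; move/eqP/negbTE: ee' => ->.
Qed.

(** The three edges of the later witness all have the value [w] at block [j] and are separated at
    block [j']. Of the three distinct values of the earlier witness at block [j], at least two
    differ from [w]: 3 + 2. *)
Lemma cross_ge5_lt j j' e e' : j < j' -> j' < b -> e < m -> e' < m ->
  cross_witness j e -> cross_witness j' e' -> 4 < #|cross chi A B|.
Proof.
move=> jj' jb' em em' [x [x' [y [y' [[xA x'A yB y'B] [d1 d2 d3] _]]]]].
move=> [u [u' [v [v' [[uA u'A vB v'B] [d4 d5 d6] /(_ _ jj')[d8 d9]]]]]].
have jb : j < b by exact: ltn_trans jb'.
set w := signed_diff j u v in d8 d9.
have [p1 [p2 [p1A p1B p2A p2B /and3P[n1 n2 n12]]]] : exists p1 p2 : T * T,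
    [/\ p1.1 \in A, p1.2 \in B, p2.1 \in A, p2.2 \in B &
     [&& signed_diff j p1.1 p1.2 != w, signed_diff j p2.1 p2.2 != w
       & signed_diff j p1.1 p1.2 != signed_diff j p2.1 p2.2]].
  have [e1|n1] := eqVneq (signed_diff j x y) w.
    exists (x, y'), (x', y); split; rewrite //= -e1 d1 d2 d3 !xpair_eqE.
    by rewrite !(ltn_eqF em) !eqxx.
  have [e2|n2] := eqVneq (signed_diff j x y') w.
    exists (x, y), (x', y); split; rewrite //= -e2 d1 d2 d3 !xpair_eqE.
    by rewrite !(gtn_eqF em) !eqxx.
  by exists (x, y), (x, y'); split; rewrite //= n1 n2 d1 d2 xpair_eqE (gtn_eqF em).
apply: (@uniq_leq_card _ _
  (fun c => (colour_diff (Ordinal jb) c, colour_diff (Ordinal jb') c)) _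
  [:: chi u v; chi u v'; chi u' v; chi p1.1 p1.2; chi p2.1 p2.2]).
  move=> z; rewrite !inE => h; apply/crossP.
  by case/or4P: h => [||| /orP[]] /eqP->;
     [exists u, v|exists u, v'|exists u', v|exists p1.1, p1.2|exists p2.1, p2.2].
rewrite /= !colour_diff_cross //= -/w d4 d5 d6 d8 d9 !inE.
have ne (p q p' q' : nat * bool) : p != q -> ((p, p') == (q, q')) = false.
  by move=> /negbTE h; rewrite xpair_eqE h.
rewrite eq_sym in n1; rewrite eq_sym in n2.
by rewrite !(ne _ _ _ _ n12, ne _ _ _ _ n1, ne _ _ _ _ n2) !xpair_eqE
           !(gtn_eqF em') !eqxx.
Qed.

Lemma cross_ge5 c c' : c \in colours chi A -> c \in colours chi B ->
  c' \in colours chi A -> c' \in colours chi B ->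
  val c.1.1.1 <> val c'.1.1.1 -> 4 < #|cross chi A B|.
Proof.
move=> cA cB c'A c'B.
have [j [e [jb em -> w]]] := common_colour cA cB.
have [j' [e' [jb' em' -> w']]] := common_colour c'A c'B.
case: (ltngtP j j') => [lt _|lt _|jj' ne].
- exact: cross_ge5_lt w w'.
- exact: cross_ge5_lt w' w.
by subst j'; apply: cross_ge5_same w w' => // ee; apply: ne; rewrite ee.
Qed.

(* As [x] and [x'] see [w] alike, the first difference of [x] and [w] in that
   block is none of the values "equal", "+", "-" produced by [c]; the edge from
   [x] to [z] therefore has a fourth colour. *)
Lemma cross_ge4 c x x' z w :
  c \in colours chi A -> c \in colours chi B -> c = chi x x' -> x \in A -> z \in B ->
  x != x' -> chi x w = chi x' w -> block (pos x x' %/ m) z = block (pos x x' %/ m) w ->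
  3 < #|cross chi A B|.
Proof.
move=> cA cB cE xA zB xx' xw bzw.
have [j [e [jb em p [u [u' [v [v' [[uA u'A vB v'B] [d1 d2 d3] _]]]]]]]] :=
  common_colour cA cB.
rewrite cE pos_chi in p.
have m0 : 0 < m by exact: leq_ltn_trans em.
have pj : pos x x' %/ m = j by rewrite p divnMDl // divn_small // addn0.
have pe : pos x x' %% m = e by rewrite p modnMDl modn_small.
have de : block_diff j x x' = e by rewrite -pj block_diff_pos.
rewrite pj in bzw.
set g := block_diff j x w.
have gx' : block_diff j x' w = g.
  by rewrite /g -!(block_diff_chi (Ordinal jb)) xw.
have gz : block_diff j x z = g.
  by apply: eq_fdiff => // t; exact: block_bit.
(* As [x] and [x'] differ at bit [j * m + e], they can neither both agree with [w] there ([g = m])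
   nor both disagree with it ([g = e]). *)
have gm : g != m.
  apply/eqP => gm; have : bit x (j * m + e) = bit x' (j * m + e).
    transitivity (bit w (j * m + e)).
      by apply: (@fdiff_agree _ bit (j * m) m); rewrite -/(block_diff _ _ _) -/g gm.
    symmetry; apply: (@fdiff_agree _ bit (j * m) m).
    by rewrite -/(block_diff _ _ _) gx' gm.
  by have := bit_pos xx'; rewrite p; do 2!case: (bit _ _).
have ge : g != e.
  apply/eqP => ge; have := bit_pos xx'; rewrite p.
  have := @fdiff_neq _ bit (j * m) m x w; rewrite -/(block_diff _ _ _) -/g ge => /(_ em).
  have := @fdiff_neq _ bit (j * m) m x' w; rewrite -/(block_diff _ _ _) gx' ge => /(_ em).
  by do 3!case: (bit _ _).
apply: (@uniq_leq_card _ _ (colour_diff (Ordinal jb)) _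
          [:: chi u v; chi u v'; chi u' v; chi x z]).
  move=> y; rewrite !inE => h; apply/crossP.
  by case/or4P: h => /eqP->;
     [exists u, v|exists u, v'|exists u', v|exists x, z].
rewrite /= !colour_diff_cross // d1 d2 d3 /signed_diff gz /= !inE !xpair_eqE.
rewrite eq_sym in gm; rewrite eq_sym in ge.
by rewrite (negbTE gm) (negbTE ge) !(gtn_eqF em) !eqxx.
Qed.

End Split.

(** * Sets with fewer colours than vertices *)

Definition tight (S : {set T}) := #|colours chi S| < #|S|.

Definition tight_split (S : {set T}) := exists A B s,
  [/\ trie_split S A B s, mono chi A B, tight A & tight B].

Lemma colours_small (S : {set T}) : #|S| <= 1 -> colours chi S = set0.
Proof.
move=> /card_le1_eqP h; apply/setP=> c; rewrite inE; apply/negP.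
by move=> /coloursP[x [y [xS yS /eqP xy _]]]; apply: xy; apply: h.
Qed.

Lemma pair_unique (S : {set T}) x y z w : #|S| <= 2 -> x \in S -> y \in S ->
  z \in S -> w \in S -> x != y -> z != w -> chi x y = chi z w.
Proof.
move=> S2 xS yS zS wS xy zw.
have SE : S = [set x; y].
  apply/esym/eqP; rewrite eqEcard subUset !sub1set xS yS /=.
  by apply: leq_trans S2 _; rewrite cards2 xy.
move: zS wS; rewrite SE !inE => /orP[]/eqP ez /orP[]/eqP ew; subst z w;
  by [| rewrite eqxx in zw | rewrite chiC].
Qed.

Lemma split_cases (S A B : {set T}) s x y : trie_split S A B s ->
  x \in S -> y \in S -> x != y ->
  (pos x y = s /\ (x \in A /\ y \in B \/ x \in B /\ y \in A))
  \/ (s < pos x y /\ (x \in A /\ y \in A \/ x \in B /\ y \in B)).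
Proof.
move=> sAB; rewrite (split_union sAB) !inE => /orP[]xS /orP[]yS xy.
- by right; split; [exact: (split_inner_left sAB)|left].
- by left; split; [exact: (split_cross sAB)|left].
- by left; split; [rewrite posC; exact: (split_cross sAB)|right].
- by right; split; [exact: (split_inner_right sAB)|right].
Qed.

Lemma split_card_gt0 (S A B : {set T}) s : trie_split S A B s ->
  0 < #|A| /\ 0 < #|B|.
Proof.
by move=> sAB; split; apply/card_gt0P; [exact: split_left sAB|exact: split_right sAB].
Qed.

Lemma mono_cross_eq (S A B : {set T}) s x y z w : trie_split S A B s ->
  mono chi A B -> x != y -> z != w ->
  x \in A /\ y \in B \/ x \in B /\ y \in A ->
  z \in A /\ w \in B \/ z \in B /\ w \in A -> chi x y = chi z w.
Proof.
move=> sAB mAB xy zw; case=> -[xS yS]; case=> -[zS wS].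
- exact: mAB.
- by rewrite (chiC zw); exact: mAB.
- by rewrite (chiC xy); exact: mAB.
- by rewrite (chiC xy) (chiC zw); exact: mAB.
Qed.

(** All cross edges of the split have one colour, and with at most 3 vertices at most one pair lies
    inside a side. *)
Lemma tight3_pos (S : {set T}) x y z w :
  #|S| <= 3 -> (1 < #|S| -> tight_split S) ->
  x \in S -> y \in S -> z \in S -> w \in S -> x != y -> z != w ->
  pos x y = pos z w -> chi x y = chi z w.
Proof.
move=> S3 ts xS yS zS wS xy zw p.
have [|A [B [s [sAB mAB _ _]]]] := ts; first by apply/card_gt1P; exists x, y.
have SAB := split_card sAB; have [A0 B0] := split_card_gt0 sAB.
case: (split_cases sAB xS yS xy) => -[p1 h1];
  case: (split_cases sAB zS wS zw) => -[p2 h2]; try by card_lia.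
  exact: mono_cross_eq sAB mAB xy zw h1 h2.
have A2 : #|A| <= 2 by card_lia.
have B2 : #|B| <= 2 by card_lia.
have gt1 (D : {set T}) u v : u \in D -> v \in D -> u != v -> 1 < #|D|.
  by move=> uD vD uv; apply/card_gt1P; exists u, v.
case: h1 h2 => -[xD yD] [] [zD wD].
- exact: (pair_unique A2).
- by have := gt1 _ _ _ xD yD xy; have := gt1 _ _ _ zD wD zw; card_lia.
- by have := gt1 _ _ _ xD yD xy; have := gt1 _ _ _ zD wD zw; card_lia.
- exact: (pair_unique B2).
Qed.

(** Edges of [A] with colours [c] and [c'] have the same position but different colours, so neither
    is a cross edge of the split of [A], and they cannot lie in the same part, by [tight3_pos]. They
    lie in opposite parts, so an endpoint [y] of the second sees both ends of the first alike, as
    [cross_ge4] demands. *)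
Lemma cross_ge4_tight (S A B : {set T}) s c c' : trie_split S A B s -> #|A| <= 4 ->
  tight_split A ->
  (forall D : {set T}, #|D| <= 3 -> tight D -> 1 < #|D| -> tight_split D) ->
  c \in colours chi A -> c \in colours chi B ->
  c' \in colours chi A -> c' \in colours chi B -> c != c' ->
  val c.1.1.1 = val c'.1.1.1 -> 3 < #|cross chi A B|.
Proof.
move=> sAB A4 [A1 [A2 [s1 [sA mA t1 t2]]]] IH cA cB c'A c'B cc' pc.
have AA := split_card sA; have [A10 A20] := split_card_gt0 sA.
have /coloursP[x [x' [xA x'A xx' cE]]] := cA.
have /coloursP[y [y' [yA y'A yy' c'E]]] := c'A.
have /coloursP[z [z' [zB z'B zz' c'E']]] := c'B.
have p : pos x x' = pos y y' by move: pc; rewrite cE c'E !pos_chi.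
have neq : chi x x' <> chi y y' by rewrite -cE -c'E; apply/eqP.
(* The edge of colour [c'] inside [B] has an endpoint with the same block as [y]. *)
have [zeta [zetaB bz]] : exists z0, z0 \in B /\
    block (pos x x' %/ m) z0 = block (pos x x' %/ m) y.
  have e : chi y y' = chi z z' by rewrite -c'E.
  by case: (chi_ends e) => -[e1 e2]; [exists z|exists z'];
    rewrite p; split=> //; symmetry.
have ok : chi x y = chi x' y -> 3 < #|cross chi A B|.
  by move=> e; exact: (cross_ge4 sAB cA cB cE xA zetaB xx' e bz).
case: (split_cases sA xA x'A xx') => -[p1 h1];
  case: (split_cases sA yA y'A yy') => -[p2 h2]; try by card_lia.
  by case: neq; exact: mono_cross_eq sA mA xx' yy' h1 h2.
have A13 : #|A1| <= 3 by card_lia.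
have A23 : #|A2| <= 3 by card_lia.
case: h1 h2 => -[xD x'D] [] [yD y'D].
- by case: neq; apply: (tight3_pos A13) => //; exact: IH.
- by apply: ok; apply: mA.
- have xy : x != y by rewrite eq_sym; exact: (split_neq sA).
  have x'y : x' != y by rewrite eq_sym; exact: (split_neq sA).
  by apply: ok; rewrite (chiC xy) (chiC x'y); apply: mA.
- by case: neq; apply: (tight3_pos A23) => //; exact: IH.
Qed.

(** With 3 vertices some side has an inner edge, and its position exceeds that of the cross edges;
    one of the two positions avoids [p]. *)
Lemma colour_other_pos (S : {set T}) p : 2 < #|S| ->
  exists2 c, c \in colours chi S & val c.1.1.1 <> p.
Proof.
move=> S3; have [|A [B [s sAB]]] := trie_split_exists (S := S).
  exact: ltnW.
have SAB := split_card sAB; have [A0 B0] := split_card_gt0 sAB.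
have inS x y : x \in S -> y \in S -> x != y -> chi x y \in colours chi S.
  by move=> xS yS xy; apply/coloursP; exists x, y.
have sA : A \subset S by rewrite (split_union sAB) subsetUl.
have sB : B \subset S by rewrite (split_union sAB) subsetUr.
have [ps|ps] := eqVneq p s; last first.
  have [x xA] := split_left sAB; have [y yB] := split_right sAB.
  exists (chi x y).
    by apply: inS; [exact: (subsetP sA)|exact: (subsetP sB)|exact: (split_neq sAB)].
  by rewrite pos_chi (split_cross sAB xA yB); apply/eqP; rewrite eq_sym.
have [A1|A1] := leqP #|A| 1.
  have /card_gt1P[x [y [xB yB xy]]] : 1 < #|B| by card_lia.
  exists (chi x y); first by apply: inS; rewrite ?(subsetP sB).
  by rewrite pos_chi; have := split_inner_right sAB xB yB xy; card_lia.
have /card_gt1P[x [y [xA yA xy]]] := A1.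
exists (chi x y); first by apply: inS; rewrite ?(subsetP sA).
by rewrite pos_chi; have := split_inner_left sAB xA yA xy; card_lia.
Qed.

(** The bound and the structure of the extremal sets are proved in one induction, because the last
    case of the bound uses the structure of smaller sets. *)
Lemma trie_colours (S : {set T}) : 0 < #|S| <= 8 ->
  #|S| <= #|colours chi S|.+1 /\ (tight S -> 1 < #|S| -> tight_split S).
Proof.
have [n] := ubnP #|S|; elim: n S => // n IH S; rewrite ltnS => Sn S8.
have [S1|S2] := leqP #|S| 1; first by split; card_lia.
have [A [B [s sAB]]] := trie_split_exists S2.
have SAB := split_card sAB; have [A0 B0] := split_card_gt0 sAB.
have [//|//|IA tA] := IH A _ _; try by card_lia.
have [//|//|IB tB] := IH B _ _; try by card_lia.
rewrite /tight (split_colours sAB).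
have X1 : 0 < #|cross chi A B|.
  have [x xA] := split_left sAB; have [y yB] := split_right sAB.
  by apply/card_gt0P; exists (chi x y); apply/crossP; exists x, y.
have cU := cardsUI (colours chi A) (colours chi B).
have [I0|] := eqVneq (colours chi A :&: colours chi B) set0.
  rewrite I0 cards0 addn0 in cU; split; first by card_lia.
  move=> tS _; exists A, B, s; split=> //; rewrite /tight; try by card_lia.
  by apply: cross1_mono; card_lia.
case/set0Pn=> c; rewrite inE => /andP[cA cB].
suff le : #|S| <= #|colours chi A :|: colours chi B| + #|cross chi A B|.
  by split; card_lia.
have UA : #|colours chi A| <= #|colours chi A :|: colours chi B|.
  by apply: subset_leq_card; exact: subsetUl.
have UB : #|colours chi B| <= #|colours chi A :|: colours chi B|.
  by apply: subset_leq_card; exact: subsetUr.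
have X3 := cross_ge3 sAB cA cB.
(* The larger side alone provides all but one of its size in colours and the smaller side has at
   most 4 vertices, so 5 cross colours suffice. This is where the limit 8 enters. *)
have [X5|X5] := ltnP 4 #|cross chi A B|; first by card_lia.
have same c' : c' \in colours chi A -> c' \in colours chi B ->
    val c'.1.1.1 = val c.1.1.1.
  move=> c'A c'B; apply/eqP; apply: contraTT X5 => /eqP ne.
  by rewrite -ltnNge; exact: (cross_ge5 sAB c'A c'B cA cB).
have A2 : 1 < #|A|.
  rewrite ltnNge; apply/negP => /colours_small e.
  by rewrite e inE in cA.
have B2 : 1 < #|B|.
  rewrite ltnNge; apply/negP => /colours_small e.
  by rewrite e inE in cB.
(* All common colours now sit at one position, so a colour of [A] at another position is missing
   from [B]. *)
have UB3 : 2 < #|A| -> #|colours chi B| < #|colours chi A :|: colours chi B|.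
  move=> A3; have [c' c'A ne] := colour_other_pos (val c.1.1.1) A3.
  apply: proper_card; apply/properP; split; first exact: subsetUr.
  by exists c'; rewrite ?inE ?c'A //; apply/negP => c'B; apply: ne; apply: same.
have UA3 : 2 < #|B| -> #|colours chi A| < #|colours chi A :|: colours chi B|.
  move=> B3; have [c' c'B ne] := colour_other_pos (val c.1.1.1) B3.
  apply: proper_card; apply/properP; split; first exact: subsetUl.
  by exists c'; rewrite ?inE ?c'B ?orbT //; apply/negP => c'A; apply: ne; apply: same.
have [|U] := leqP #|S| (#|colours chi A :|: colours chi B| + #|cross chi A B|) => //.
(* The count can fail only for 4 + 4 vertices with 3 colours on each side, 4 in the union and 3
   across. Then two colours are common, and they force a fourth cross colour. *)
have [A4 B4 CA CB] : [/\ #|A| = 4, #|B| = 4, #|colours chi A| = 3 & #|colours chi B| = 3].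
  by split; card_lia.
have IH3 (D : {set T}) : #|D| <= 3 -> tight D -> 1 < #|D| -> tight_split D.
  move=> D3 tD D1; have lt : #|D| < n by card_lia.
  have D8 : 0 < #|D| <= 8 by card_lia.
  by case: (IH D lt D8) => _ ts; exact: ts.
have /card_gt1P[c1 [c2 [c1I c2I c12]]] : 1 < #|colours chi A :&: colours chi B| by card_lia.
move: c1I c2I; rewrite !inE => /andP[c1A c1B] /andP[c2A c2B].
suff : 3 < #|cross chi A B| by card_lia.
have ts : tight_split A by apply: tA; rewrite /tight; card_lia.
apply: (cross_ge4_tight sAB _ ts IH3 c1A c1B c2A c2B c12); first by card_lia.
by rewrite !same.
Qed.

Lemma trie_mono_tree (S : {set T}) : 0 < #|S| <= 8 -> tight S -> mono_tree chi S.
Proof.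
have [n] := ubnP #|S|; elim: n S => // n IH S; rewrite ltnS => Sn S8 tS.
have [S1|S2] := leqP #|S| 1.
  have /cards1P[x ->] : #|S| == 1 by card_lia.
  exact: MonoLeaf.
have [_ /(_ tS S2)[A [B [s [sAB mAB tA tB]]]]] := trie_colours S8.
have SAB := split_card sAB; have [A0 B0] := split_card_gt0 sAB.
rewrite (split_union sAB); apply: MonoNode (split_disjoint sAB) mAB.
  by apply: IH => //; card_lia.
by apply: IH => //; card_lia.
Qed.
End TrieColouring.

(** * The algebraic colouring *)

Section AlgebraicColouring.
Variables (F : finFieldType) (d n : nat) (g : 'I_n -> 'rV[F]_d.+1).
Hypothesis g_inj : injective g.
Local Open Scope ring_scope.

Definition form (x y : 'I_n) : F :=
  g x 0 0 + g y 0 0 + \sum_(i < d) g x 0 (lift ord0 i) * g y 0 (lift ord0 i).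

(* The coordinate 0 takes precedence, so that a monochromatic pair of sets with
   any other index has a single value at coordinate 0. *)
Definition diff_coord (x y : 'I_n) : 'I_d.+1 :=
  if g x 0 0 != g y 0 0 then ord0 else odflt ord0 [pick i | g x 0 i != g y 0 i].

(** [enum_rank] provides an arbitrary linear order on the field, used to orient edges. *)
Definition coord_lt (x y : 'I_n) : bool :=
  let i := diff_coord x y in
  leq (enum_rank (g x 0 i)).+1 (enum_rank (g y 0 i)).

Definition phi_lt (x y : 'I_n) : ('I_d.+1 * bool * bool * F)%type :=
  let up := form x y == form x x in
  let down := form x y == form y y in
  let i := diff_coord x y in
  (i, up, down, if up || down then g x 0 i + g y 0 i else form x y).

Definition phi (x y : 'I_n) := if coord_lt x y then phi_lt x y else phi_lt y x.

Lemma formC x y : form x y = form y x.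
Proof.
rewrite /form [X in X + _]addrC; congr (_ + _).
by apply: eq_bigr => i _; rewrite mulrC.
Qed.

Lemma diff_coordC x y : diff_coord x y = diff_coord y x.
Proof.
rewrite /diff_coord eq_sym; case: ifP => // _; congr odflt.
by apply: eq_pick => i; rewrite eq_sym.
Qed.

Lemma diff_coord_neq x y : x != y -> g x 0 (diff_coord x y) != g y 0 (diff_coord x y).
Proof.
move=> xy; rewrite /diff_coord; case: ifP => // /negbFE/eqP e0.
case: pickP => //= h; case/eqP: xy; apply: g_inj; apply/rowP => i.
by apply/eqP; move/negbFE: (h i).
Qed.

Lemma diff_coord_first x y : diff_coord x y != ord0 -> g x 0 0 = g y 0 0.
Proof. by rewrite /diff_coord; case: ifP => [_|/negbFE/eqP //]; rewrite eqxx. Qed.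

Lemma coord_ltC x y : x != y -> coord_lt y x = ~~ coord_lt x y.
Proof.
move=> xy; rewrite /coord_lt (diff_coordC y x) -leqNgt ltn_neqAle.
suff -> : enum_rank (g y 0 (diff_coord x y)) != enum_rank (g x 0 (diff_coord x y)) :> nat by [].
by rewrite (inj_eq val_inj) (inj_eq enum_rank_inj) eq_sym diff_coord_neq.
Qed.

Lemma phiC x y : x != y -> phi x y = phi y x.
Proof. by move=> xy; rewrite /phi (coord_ltC xy); case: (coord_lt x y). Qed.

(** [PhiDot] is the generic case; in [PhiSquare] the colour stores a coordinate sum. Constancy at
    coordinate 0 prepares the second alternative of [hat_rank_le]. *)
Variant phi_mono_spec (A B : {set 'I_n}) : Prop :=
| PhiDot c of (forall x y, x \in A -> y \in B ->
    [/\ form x y = c, form x x != c & form y y != c])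
| PhiSquare i (u v : F) of u != v
    & (forall x, x \in A -> g x 0 i = u) & (forall y, y \in B -> g y 0 i = v)
    & (exists u0, forall x, x \in A -> g x 0 0 = u0)
    & (exists v0, forall y, y \in B -> g y 0 0 = v0)
    & (forall x y, x \in A -> y \in B -> form x y = form x x) \/
      (forall x y, x \in A -> y \in B -> form x y = form y y).

Lemma phi_monoP (A B : {set 'I_n}) x0 y0 : x0 \in A -> y0 \in B ->
  [disjoint A & B] -> mono phi A B -> phi_mono_spec A B.
Proof.
move=> x0A y0B dAB mAB.
have ne x y : x \in A -> y \in B -> x != y.
  by move=> xA yB; apply: contraTneq yB => <-; rewrite (disjointFr dAB).
set i := diff_coord x0 y0; set c := form x0 y0.
have icol x y : (phi x y).1.1.1 = diff_coord x y.
  by rewrite /phi; case: ifP => _ //=; rewrite diff_coordC.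
have di x y : x \in A -> y \in B -> diff_coord x y = i.
  by move=> xA yB; rewrite -icol (mAB x x0 y y0) // icol.
pose sq x y := (form x y == form x x) || (form x y == form y y).
have sqcol x y : (phi x y).1.1.2 || (phi x y).1.2 = sq x y.
  by rewrite /phi; case: ifP => _ //=; rewrite /sq (formC y x) orbC.
have sqE x y : x \in A -> y \in B -> sq x y = sq x0 y0.
  by move=> xA yB; rewrite -!sqcol (mAB x x0 y y0).
have val_col x y : (phi x y).2 =
    let i := diff_coord x y in if sq x y then g x 0 i + g y 0 i else form x y.
  rewrite /phi; case: ifP => _ //=.
  by rewrite -/(sq y x) /sq (formC y x) orbC (diff_coordC y x) addrC.
have [s0|s0] := boolP (sq x0 y0); last first.
  apply: (@PhiDot _ _ c) => x y xA yB.
  have nsq : ~~ sq x y by rewrite sqE.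
  have e : form x y = c.
    by have := congr1 snd (mAB x x0 y y0 xA x0A yB y0B); rewrite !val_col (negbTE nsq) (negbTE s0).
  by move: nsq; rewrite /sq e negb_or ![c == _]eq_sym => /andP[].
have sumE x y : x \in A -> y \in B -> g x 0 i + g y 0 i = g x0 0 i + g y0 0 i.
  move=> xA yB; have := congr1 snd (mAB x x0 y y0 xA x0A yB y0B).
  by rewrite !val_col sqE // s0 !di.
have uA x : x \in A -> g x 0 i = g x0 0 i.
  by move=> xA; have /addIr := sumE x y0 xA y0B.
have vB y : y \in B -> g y 0 i = g y0 0 i.
  by move=> yB; have /addrI := sumE x0 y x0A yB.
have uv : g x0 0 i != g y0 0 i by apply: diff_coord_neq; exact: ne.
have c0 : (exists u0, forall x, x \in A -> g x 0 0 = u0) /\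
          (exists v0, forall y, y \in B -> g y 0 0 = v0).
  have [i0|i0] := eqVneq i ord0.
    by split; [exists (g x0 0 0) => x /uA|exists (g y0 0 0) => y /vB]; rewrite i0.
  have first x y : x \in A -> y \in B -> g x 0 0 = g y 0 0.
    by move=> xA yB; apply: diff_coord_first; rewrite di.
  split; first by exists (g y0 0 0) => x xA; exact: first.
  by exists (g x0 0 0) => y yB; rewrite -(first x0).
apply: (PhiSquare uv uA vB c0.1 c0.2).
(* Both sides being constant at coordinate [i], all cross edges are oriented alike, so each flag
   refers to the same side throughout. *)
have ltE x y : x \in A -> y \in B -> coord_lt x y = coord_lt x0 y0.
  by move=> xA yB; rewrite /coord_lt /= !di // (uA x) // (vB y).
have up_col x y : x \in A -> y \in B ->
    (phi x y).1.1.2 = (form x y == if coord_lt x0 y0 then form x x else form y y).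
  by move=> xA yB; rewrite /phi ltE //; case: ifP => _ //=; rewrite formC.
have down_col x y : x \in A -> y \in B ->
    (phi x y).1.2 = (form x y == if coord_lt x0 y0 then form y y else form x x).
  by move=> xA yB; rewrite /phi ltE //; case: ifP => _ //=; rewrite formC.
move: s0; rewrite -sqcol => /orP[] h.
  have {}h x y : x \in A -> y \in B ->
      form x y = if coord_lt x0 y0 then form x x else form y y.
    by move=> xA yB; apply/eqP; rewrite -up_col // (mAB x x0 y y0).
  by case: (coord_lt x0 y0) h; [left|right].
have {}h x y : x \in A -> y \in B ->
    form x y = if coord_lt x0 y0 then form y y else form x x.
  by move=> xA yB; apply/eqP; rewrite -down_col // (mAB x x0 y y0).
by case: (coord_lt x0 y0) h; [right|left].
Qed.

(** * Ranks of the vectors extended by a leading 1 *)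

Definition hat (x : 'I_n) : 'rV[F]_d.+2 :=
  \row_j (if unlift ord0 j is Some k then g x 0 k else 1).

(** Zero rows outside [A] give the matrices of all sets the same shape. *)
Definition hat_mx (A : {set 'I_n}) : 'M[F]_(n, d.+2) :=
  \matrix_x (if x \in A then hat x else 0).

Definition hat_rank (A : {set 'I_n}) := \rank (hat_mx A).

Lemma hat0 x : hat x 0 0 = 1.
Proof. by rewrite mxE unlift_none. Qed.

Lemma hat_lift x k : hat x 0 (lift ord0 k) = g x 0 k.
Proof. by rewrite mxE liftK. Qed.

Lemma mul_hat_mx (v : 'rV[F]_n) (A : {set 'I_n}) j :
  (v *m hat_mx A) 0 j = \sum_(x in A) v 0 x * hat x 0 j.
Proof.
rewrite mxE [RHS]big_mkcond; apply: eq_bigr => x _.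
by rewrite mxE; case: ifP => // _; rewrite mxE mulr0.
Qed.

Lemma hat_sub x (A : {set 'I_n}) : x \in A -> (hat x <= hat_mx A)%MS.
Proof.
by move=> xA; have := row_sub x (hat_mx A); rewrite rowK xA.
Qed.

Lemma hat_mx_sub (A B : {set 'I_n}) : A \subset B -> (hat_mx A <= hat_mx B)%MS.
Proof.
move=> /subsetP sAB; apply/row_subP => x; rewrite rowK.
by case: ifP => [xA|_]; [exact/hat_sub/sAB|exact: sub0mx].
Qed.

(* [form x y - k x] is the pairing of [hat y] with the row [N x] below; adding
   multiples of the first basis vector does not lower the rank under either
   hypothesis. *)
Lemma hat_rank_le (A B : {set 'I_n}) (k : 'I_n -> F) :
  (forall x y, x \in A -> y \in B -> form x y = k x) ->
  (exists c, forall x, x \in A -> k x = c) \/ (exists c, forall x, x \in A -> g x 0 0 = c) ->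
  (hat_rank A + hat_rank B <= d.+2)%N.
Proof.
move=> fk cst.
pose N x : 'rV[F]_d.+2 := \row_j
  (if unlift ord0 j is Some i then
     if unlift ord0 i is Some i' then g x 0 i else 1 else g x 0 0 - k x).
pose NA : 'M[F]_(n, d.+2) := \matrix_x (if x \in A then N x else 0).
have N_hat x y : \sum_j N x 0 j * hat y 0 j = form x y - k x.
  rewrite big_ord_recl [X in _ + X]big_ord_recl hat0 !hat_lift !mxE.
  rewrite unlift_none liftK unlift_none mulr1 mul1r /form addrA [RHS]addrAC; congr (_ + _).
    by rewrite addrAC.
  by apply: eq_bigr => i _; rewrite hat_lift mxE !liftK.
have orth : NA *m (hat_mx B)^T = 0.
  apply/matrixP => x y; rewrite [RHS]mxE mxE.
  transitivity (\sum_j (if x \in A then N x else 0) 0 j * (if y \in B then hat y else 0) 0 j).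
    by apply: eq_bigr => j _; rewrite !mxE.
  case: ifP => [xA|_]; last by rewrite big1 // => j _; rewrite mxE mul0r.
  case: ifP => [yB|_]; last by rewrite big1 // => j _; rewrite [X in _ * X]mxE mulr0.
  by rewrite N_hat fk // subrr.
have mulN (v : 'rV[F]_n) j : (v *m NA) 0 j = \sum_(x in A) v 0 x * N x 0 j.
  rewrite mxE [RHS]big_mkcond; apply: eq_bigr => x _.
  by rewrite mxE; case: ifP => // _; rewrite mxE mulr0.
(* The entry 1 of [N x] makes the weights [v] sum to 0 over [A], so any function constant on [A] has
   weighted sum 0. This recovers the column of [g x 0 0] from that of [g x 0 0 - k x]. *)
have ker (v : 'rV[F]_n) : v *m NA = 0 -> v *m hat_mx A = 0.
  move=> vN.
  have v1 : \sum_(x in A) v 0 x = 0.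
    transitivity ((v *m NA) 0 (lift ord0 ord0)); last by rewrite vN mxE.
    by rewrite mulN; apply: eq_bigr => x _; rewrite mxE liftK unlift_none mulr1.
  have cst0 h : (exists c, forall x, x \in A -> h x = c) -> \sum_(x in A) v 0 x * h x = 0.
    case=> c hc; rewrite (eq_bigr (fun x => v 0 x * c)); last by move=> x /hc ->.
    by rewrite -mulr_suml v1 mul0r.
  have vk : \sum_(x in A) v 0 x * (g x 0 0 - k x) = 0.
    transitivity ((v *m NA) 0 ord0); last by rewrite vN mxE.
    by rewrite mulN; apply: eq_bigr => x _; rewrite mxE unlift_none.
  have v0 : \sum_(x in A) v 0 x * g x 0 0 = 0.
    case: cst => [ck|]; last exact: cst0.
    transitivity (\sum_(x in A) v 0 x * (g x 0 0 - k x) + \sum_(x in A) v 0 x * k x).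
      by rewrite -big_split; apply: eq_bigr => x _ /=; rewrite -mulrDr subrK.
    by rewrite vk cst0 // addr0.
  apply/rowP => j; rewrite mul_hat_mx [RHS]mxE.
  case: (unliftP ord0 j) => [i ->|->]; last first.
    by rewrite -[RHS]v1; apply: eq_bigr => x _; rewrite hat0 mulr1.
  case: (unliftP ord0 i) => [i' ->|->]; last first.
    by rewrite -[RHS]v0; apply: eq_bigr => x _; rewrite hat_lift.
  transitivity ((v *m NA) 0 (lift ord0 (lift ord0 i'))); last by rewrite vN mxE.
  by rewrite mulN; apply: eq_bigr => x _; rewrite hat_lift mxE !liftK.
have kerS : (kermx NA <= kermx (hat_mx A))%MS.
  apply/row_subP => r; apply/sub_kermxP; apply: ker.
  by rewrite -row_mul mulmx_ker row0.
have := mxrankS kerS; rewrite !mxrank_ker => le1.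
have := mulmx0_rank_max orth; rewrite mxrank_tr.
have := rank_leq_row NA; have := rank_leq_row (hat_mx A).
by rewrite /hat_rank; lia.
Qed.

(** The leading 1 turns linear combinations into affine ones, which preserve a constant
    coordinate. *)
Lemma hat_notin (A : {set 'I_n}) y i u : (forall x, x \in A -> g x 0 i = u) ->
  g y 0 i != u -> ~~ (hat y <= hat_mx A)%MS.
Proof.
move=> uA yu; apply/negP => /submxP[v e].
have v1 : \sum_(x in A) v 0 x = 1.
  by rewrite -(hat0 y) e mul_hat_mx; apply: eq_bigr => x _; rewrite hat0 mulr1.
case/eqP: yu; rewrite -hat_lift e mul_hat_mx -[u]mul1r -v1 mulr_suml.
by apply: eq_bigr => x xA; rewrite hat_lift uA.
Qed.

(** [form y] is affine in its second argument, so an affine combination [y] of [A] would satisfy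
    [form y y = c]. *)
Lemma hat_notin_form (A : {set 'I_n}) y c : (forall x, x \in A -> form y x = c) ->
  form y y != c -> ~~ (hat y <= hat_mx A)%MS.
Proof.
move=> cA yc; apply/negP => /submxP[v e].
have v1 : \sum_(x in A) v 0 x = 1.
  by rewrite -(hat0 y) e mul_hat_mx; apply: eq_bigr => x _; rewrite hat0 mulr1.
have vg i : g y 0 i = \sum_(x in A) v 0 x * g x 0 i.
  by rewrite -hat_lift e mul_hat_mx; apply: eq_bigr => x _; rewrite hat_lift.
case/eqP: yc.
transitivity (\sum_(x in A) v 0 x * form y x); last first.
  by rewrite (eq_bigr (fun x => v 0 x * c)) => [|x /cA ->//]; rewrite -mulr_suml v1 mul1r.
rewrite {1}/form -{1}[g y 0 0]mul1r -v1 mulr_suml [X in _ + X + _]vg -big_split /=.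
transitivity (\sum_(x in A) (v 0 x * g y 0 0 + v 0 x * g x 0 0)
   + \sum_(x in A) \sum_(i < d) v 0 x * (g y 0 (lift ord0 i) * g x 0 (lift ord0 i))).
  congr (_ + _); rewrite exchange_big; apply: eq_bigr => i _ /=.
  rewrite {2}vg mulr_sumr; apply: eq_bigr => x _; exact: mulrCA.
rewrite -big_split; apply: eq_bigr => x _ /=.
by rewrite -mulr_sumr -!mulrDr.
Qed.

Lemma hat_rank_lt (A : {set 'I_n}) y (S : {set 'I_n}) : A \subset S -> y \in S ->
  ~~ (hat y <= hat_mx A)%MS -> (hat_rank A < hat_rank S)%N.
Proof.
move=> sAS yS ny; have := ltmxErank (hat_mx A) (hat_mx S).
rewrite hat_mx_sub //= => <-; rewrite /ltmx hat_mx_sub //=.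
by apply: contra ny; apply: submx_trans; exact: hat_sub.
Qed.

Lemma mono_hat_rank (A B : {set 'I_n}) x0 y0 : x0 \in A -> y0 \in B ->
  [disjoint A & B] -> mono phi A B ->
  [/\ (hat_rank A + hat_rank B <= d.+2)%N,
       (hat_rank A < hat_rank (A :|: B))%N & (hat_rank B < hat_rank (A :|: B))%N].
Proof.
move=> x0A y0B dAB mAB.
have sA : A \subset A :|: B by exact: subsetUl.
have sB : B \subset A :|: B by exact: subsetUr.
have xS : x0 \in A :|: B by rewrite inE x0A.
have yS : y0 \in A :|: B by rewrite inE y0B orbT.
case: (phi_monoP x0A y0B dAB mAB) => [c h|i u v uv uA vB cA cB h].
  have [_ nx ny] := h _ _ x0A y0B; split.
  - apply: (@hat_rank_le A B (fun=> c)); last by left; exists c.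
    by move=> x y xA yB; have [] := h _ _ xA yB.
  - apply: (hat_rank_lt sA yS); apply: (@hat_notin_form A y0 c) => // x xA.
    by rewrite formC; have [] := h _ _ xA y0B.
  - apply: (hat_rank_lt sB xS); apply: (@hat_notin_form B x0 c) => // y yB.
    by have [] := h _ _ x0A yB.
split.
- case: h => h.
    by apply: (@hat_rank_le A B (fun x => form x x)) => //; right.
  rewrite addnC; apply: (@hat_rank_le B A (fun y => form y y)); last by right.
  by move=> x y xB yA; rewrite formC h.
- apply: (hat_rank_lt sA yS); apply: (@hat_notin A y0 i u) => //.
  by rewrite vB // eq_sym.
- by apply: (hat_rank_lt sB xS); apply: (@hat_notin B x0 i v) => //; rewrite uA.
Qed.

Lemma hat_rank_gt0 (S : {set 'I_n}) x : x \in S -> (0 < hat_rank S)%N.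
Proof.
move=> xS; apply: leq_trans (mxrankS (hat_sub xS)).
rewrite lt0n mxrank_eq0; apply/eqP => /rowP/(_ 0); rewrite hat0 mxE.
by apply/eqP; rewrite oner_neq0.
Qed.

Lemma mono_tree_card (S : {set 'I_n}) : mono_tree phi S -> (#|S| <= 2 ^ (hat_rank S).-1)%N.
Proof.
elim=> [x|A B tA IA tB IB dAB mAB]; first by rewrite cards1 expn_gt0.
have [x xA] := mono_tree_neq0 tA; have [y yB] := mono_tree_neq0 tB.
have [_ rA rB] := mono_hat_rank xA yB dAB mAB.
have A0 := hat_rank_gt0 xA; have B0 := hat_rank_gt0 yB.
rewrite cardsU (disjoint_setI0 dAB) cards0 subn0.
case: (hat_rank (A :|: B)) rA rB => [|[|r]] rA rB; first by rewrite ltn0 in rA.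
  by move: A0 rA; case: (hat_rank A).
rewrite succnK expnS mul2n -addnn; apply: leq_add.
  by apply: leq_trans IA _; rewrite leq_exp2l //; lia.
by apply: leq_trans IB _; rewrite leq_exp2l //; lia.
Qed.

Lemma mono_tree_rank (S : {set 'I_n}) k : mono_tree phi S ->
  (2 ^ k < #|S|)%N -> (k.+1 < hat_rank S)%N.
Proof.
move=> tS kS; have := leq_trans kS (mono_tree_card tS).
by rewrite ltn_exp2l //; lia.
Qed.

Lemma mono_tree_split (S : {set 'I_n}) : mono_tree phi S -> (1 < #|S|)%N ->
  exists A B : {set 'I_n}, [/\ mono_tree phi A, mono_tree phi B, (#|S| = #|A| + #|B|)%N,
    (0 < #|A|)%N /\ (0 < #|B|)%N &
    [/\ (hat_rank A + hat_rank B <= d.+2)%N, (hat_rank A < hat_rank S)%N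
      & (hat_rank B < hat_rank S)%N]].
Proof.
case=> [x|A B tA tB dAB mAB _]; first by rewrite cards1.
have [x xA] := mono_tree_neq0 tA; have [y yB] := mono_tree_neq0 tB.
exists A, B; split=> //; last exact: mono_hat_rank xA yB dAB mAB.
  by rewrite cardsU (disjoint_setI0 dAB) cards0 subn0.
by split; apply/card_gt0P; [exists x|exists y].
Qed.

End AlgebraicColouring.

(** * Monochromatic trees with 6, 7 and 8 vertices *)

Section SmallTrees.
Variables (F : finFieldType) (d n : nat) (g : 'I_n -> 'rV[F]_d.+1).
Hypothesis g_inj : injective g.

Lemma mono_tree_rank_bounds (S : {set 'I_n}) : mono_tree (phi g) S ->
  [/\ 0 < hat_rank g S, 1 < #|S| -> 1 < hat_rank g S, 2 < #|S| -> 2 < hat_rank g S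
    & 4 < #|S| -> 3 < hat_rank g S].
Proof.
move=> tS; have [x xS] := mono_tree_neq0 tS; split; first exact: (hat_rank_gt0 g xS).
- exact: (mono_tree_rank g_inj (k := 0) tS).
- exact: (mono_tree_rank g_inj (k := 1) tS).
- exact: (mono_tree_rank g_inj (k := 2) tS).
Qed.

(** The ranks of the two sides sum to at most 4, whereas the splits 5 + 1, 4 + 2 and 3 + 3 need at
    least 5, 5 and 6. *)
Lemma mono_tree_size6 (S : {set 'I_n}) : d = 2 -> #|S| = 6 -> ~ mono_tree (phi g) S.
Proof.
move=> d2 S6 tS.
have [|A [B [tA tB SAB [A0 B0] [le _ _]]]] := mono_tree_split g_inj tS.
  by rewrite S6.
have [A1 A2 A3 A5] := mono_tree_rank_bounds tA.
have [B1 B2 B3 B5] := mono_tree_rank_bounds tB.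
by lia.
Qed.

(** A side with 5 vertices has rank at least 4, and the union exceeds it. Otherwise both sides have
    3 or 4 vertices and ranks at least 3, beyond the total of 5. *)
Lemma mono_tree_size7 (S : {set 'I_n}) : d = 3 -> 6 < #|S| -> mono_tree (phi g) S ->
  4 < hat_rank g S.
Proof.
move=> d3 S7 tS.
have [|A [B [tA tB SAB [A0 B0] [le ltA ltB]]]] := mono_tree_split g_inj tS.
  exact: leq_trans S7.
have [A1 A2 A3 A5] := mono_tree_rank_bounds tA.
have [B1 B2 B3 B5] := mono_tree_rank_bounds tB.
by lia.
Qed.

(** The ranks sum to at most 5. The doubling bound allows 4 + 1 for the split 7 + 1, which
    [mono_tree_size7] raises to 5 + 1; the splits 6 + 2, 5 + 3 and 4 + 4 need at least 6, 7 and
    6. *)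
Lemma mono_tree_size8 (S : {set 'I_n}) : d = 3 -> #|S| = 8 -> ~ mono_tree (phi g) S.
Proof.
move=> d3 S8 tS.
have [|A [B [tA tB SAB [A0 B0] [le _ _]]]] := mono_tree_split g_inj tS.
  by rewrite S8.
have [A1 A2 A3 A5] := mono_tree_rank_bounds tA.
have [B1 B2 B3 B5] := mono_tree_rank_bounds tB.
have A7 := mono_tree_size7 d3 ^~ tA; have B7 := mono_tree_size7 d3 ^~ tB.
by lia.
Qed.

End SmallTrees.

(** * Combining the two colourings *)

Lemma mono_tree_map (T C C' : finType) (f : T -> T -> C) (h : C -> C') S :
  mono_tree f S -> mono_tree (fun x y => h (f x y)) S.
Proof.
elim=> [x|A B _ tA _ tB dAB mAB]; first exact: MonoLeaf.
by apply: MonoNode => // a a' b b' aA a'A bB b'B; rewrite (mAB a a' b b').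
Qed.

Lemma card_embedding n (U : finType) : n <= #|U| -> exists h : 'I_n -> U, injective h.
Proof.
move=> le; exists (fun i => enum_val (widen_ord le i)) => i j /enum_val_inj e.
by apply: val_inj; exact: (congr1 val e).
Qed.

Lemma good_of_colours (C : finType) n p q (f : 'I_n -> 'I_n -> C) :
  (forall x y, x != y -> f x y = f y x) ->
  (forall S : {set 'I_n}, #|S| = p -> q <= #|colours f S|) -> good n p q #|C|.
Proof.
move=> fC fpq; exists (fun x y => enum_rank (f x y) : nat); split.
  by move=> x y /fC ->; split.
move=> S /fpq le; apply: leq_trans le _; rewrite cardE -(size_map (fun c => enum_rank c : nat)).
apply: uniq_leq_size.
  by rewrite map_inj_uniq ?enum_uniq // => c c' /val_inj/enum_rank_inj.
move=> k /mapP[c]; rewrite mem_enum => /coloursP[x [y [xS yS xy ->]]] ->.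
rewrite /clique_colors mem_undup; apply/mapP; exists (x, y) => //.
by rewrite mem_filter /= xy; apply/allpairsP; exists (x, y); rewrite !mem_enum.
Qed.

Lemma fnpq_le n p q k : good n p q k -> fnpq n p q <= k.
Proof.
move=> gk; rewrite /fnpq; case: pselect => // h.
by case: ex_minnP => k0 _; apply; apply/asboolP.
Qed.

(** The factors are the numbers of colours available to [chi] and to [phi] over a field with [2 ^ k]
    elements. *)
Definition colour_bound (d b m k : nat) : nat :=
  ((b * m).+1 * 2 ^ m * 2 ^ m * (m.+1 * 2) ^ b) * (d.+1 * 2 * 2 * 2 ^ k).

Lemma fnpq_colour_bound (d p n b m k : nat) : 0 < p <= 8 -> 0 < k ->
  n <= 2 ^ (b * m) -> n <= 2 ^ (k * d.+1) ->
  (forall (F : finFieldType) (g : 'I_n -> 'rV[F]_d.+1) (S : {set 'I_n}),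
     injective g -> #|S| = p -> ~ mono_tree (phi g) S) ->
  fnpq n p p <= colour_bound d b m k.
Proof.
move=> p8 k0 nbm nkd no_tree.
have [F _ cardF] := pPrimePowerField (isT : prime 2) k0.
have [|h h_inj] := @card_embedding n ((b * m).-tuple bool).
  by rewrite card_tuple card_bool.
have [|g g_inj] := @card_embedding n 'rV[F]_d.+1.
  by rewrite card_mx cardF mul1n -expnM.
pose bit (x : 'I_n) := nth false (h x).
have pos_lt x y : x != y -> pos bit b m x y < b * m.
  move=> xy; rewrite ltnNge; apply: contra xy => le; apply/eqP/h_inj/val_inj.
  apply: (@eq_from_nth _ false); rewrite ?size_tuple // => i ilt.
  have := @fdiff_agree _ bit 0 (b * m) x y i; rewrite add0n; apply.
  exact: leq_trans ilt le.
pose f x y := (chi bit b m x y, phi g x y).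
apply: leq_trans (fnpq_le (@good_of_colours _ n p p f _ _)) _.
- by move=> x y xy; rewrite /f (chiC pos_lt xy) (phiC g_inj xy).
- move=> S Sp; rewrite leqNgt; apply/negP => lt.
  have S8 : 0 < #|S| <= 8 by rewrite Sp.
  have chiE : colours (chi bit b m) S = fst @: colours f S.
    by rewrite /colours -imset_comp.
  have le : #|colours (chi bit b m) S| <= #|colours f S|.
    by rewrite chiE leq_imset_card.
  (* [chi] has at least [p - 1] colours on [S] and the product at most [p - 1], so [S] is tight for
     [chi] and both colourings have equally many colours. *)
  have [ge _] := trie_colours pos_lt S8.
  have tS : mono_tree (chi bit b m) S.
    by apply: trie_mono_tree => //; rewrite /tight Sp (leq_ltn_trans le).
  have tf : mono_tree f S.
    have eq_card : #|colours f S| <= #|colours (chi bit b m) S|.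
      by rewrite -ltnS (leq_trans lt) // -Sp.
    exact: (@mono_tree_refine _ _ _ f fst).
  exact: (no_tree F g S g_inj Sp (mono_tree_map snd tf)).
rewrite !card_prod !card_ffun !card_ord !card_bool cardF !card_prod.
by rewrite !card_ord card_bool /colour_bound.
Qed.

(** * Asymptotics *)

Section Asymptotics.
Local Open Scope R_scope.

Lemma exp_INR_mul (n : nat) (x : R) : exp (INR n * x) = exp x ^ n.
Proof.
elim: n => [|n IH]; first by rewrite /= Rmult_0_l exp_0.
by rewrite S_INR Rmult_plus_distr_r Rmult_1_l exp_plus IH /= Rmult_comm.
Qed.

Lemma INR_expn (a n : nat) : INR (expn a n) = INR a ^ n.
Proof. by elim: n => [|n IH] //=; rewrite expnS mult_INR IH. Qed.

Lemma INR_le (m n : nat) : (m <= n)%N -> INR m <= INR n.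
Proof. by move=> /leP; exact: le_INR. Qed.

(** With [c = (a + 1) e], the exponential is the power [a + 1] of [exp (e t)], which is at least
    [e t]; this gains a factor [t] over the power [a]. The constant 3 comes from [t + 2 <= 3 t] for
    [t >= 1]. *)
Lemma poly_le_exp (a : nat) (C c : R) : 0 < C -> 0 < c ->
  exists T : nat, forall t : nat, (T <= t)%N ->
    C * (INR t + 2) ^ a <= exp (c * INR t).
Proof.
move=> C0 c0; set s := INR a.+1.
have s0 : 0 < s by apply: lt_0_INR; lia.
have [e [e0 ce]] : exists e, 0 < e /\ c = s * e.
  by exists (c / s); split; [exact: Rdiv_lt_0_compat|field; lra].
have ea0 : 0 < e ^ a.+1 by apply: pow_lt.
have [T0 hT] := INR_archimed _ (C * 3 ^ a) ea0.
exists T0.+1 => t Tt.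
have t1 : 1 <= INR t by rewrite -[1]/(INR 1); apply: INR_le; lia.
have tT : C * 3 ^ a <= INR t * e ^ a.+1.
  apply: Rle_trans (Rlt_le _ _ hT) _; apply: Rmult_le_compat_r; first by lra.
  by apply: INR_le; lia.
have -> : c * INR t = INR a.+1 * (e * INR t).
  by rewrite -/s ce; ring.
rewrite exp_INR_mul.
apply: (Rle_trans _ ((e * INR t) ^ a.+1)); last first.
  apply: pow_incr; split; first by apply: Rmult_le_pos; lra.
  by have := exp_ineq1_le (e * INR t); lra.
apply: (Rle_trans _ (C * (3 * INR t) ^ a)).
  by apply: Rmult_le_compat_l; [lra|apply: pow_incr; lra].
rewrite !Rpow_mult_distr -[INR t ^ a.+1]/(INR t * INR t ^ a).
have ta0 : 0 <= INR t ^ a by apply: pow_le; lra.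
have := Rmult_le_compat_r _ _ _ ta0 tT.
by move: (e ^ a.+1) (3 ^ a) (INR t ^ a) => u v w; lra.
Qed.

(** For fixed [b] and [d], all factors except [2 ^ m] (twice) and [2 ^ k] are polynomial in [t]. *)
Lemma colour_bound_le (d b t : nat) : (0 < b)%N ->
  (colour_bound d b (t %/ b).+1 (t %/ d.+1).+1
   <= b * 2 ^ b * (4 * d.+1) * (t + 2) ^ b.+1
      * 2 ^ (2 * (t %/ b).+1 + (t %/ d.+1).+1))%N.
Proof.
move=> b0; set m := (t %/ b).+1; set k := (t %/ d.+1).+1.
have mt : (m <= t.+1)%N by rewrite ltnS leq_div.
have e1 : ((b * m).+1 <= b * (t + 2))%N by nia.
have e2 : ((m.+1 * 2) ^ b <= 2 ^ b * (t + 2) ^ b)%N.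
  by rewrite -expnMn leq_exp2r //; lia.
rewrite /colour_bound expnD mulnC.
have -> : (b * 2 ^ b * (4 * d.+1) * (t + 2) ^ b.+1 * (2 ^ (2 * m) * 2 ^ k) =
  (d.+1 * 2 * 2 * 2 ^ k) * ((b * (t + 2)) * 2 ^ m * 2 ^ m * (2 ^ b * (t + 2) ^ b)))%N.
  rewrite mul2n -addnn expnD expnS.
  by move: (2 ^ m)%N (2 ^ k)%N (2 ^ b)%N ((t + 2) ^ b)%N => u v w x; clear; lia.
by rewrite leq_mul2l !leq_mul ?orbT.
Qed.

Lemma fnpq_asymptotic (d p : nat) : (0 < p <= 8)%N ->
  (forall n (F : finFieldType) (g : 'I_n -> 'rV[F]_d.+1) (S : {set 'I_n}),
     injective g -> #|S| = p -> ~ mono_tree (phi g) S) ->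
  forall eps : R, 0 < eps -> exists N : nat, forall n : nat, (N <= n)%N ->
    INR (fnpq n p p) <= Rpower (INR n) (1 / INR d.+1 + eps).
Proof.
move=> p8 no_tree eps eps0.
(* This [b] makes the two block factors cost at most [2 * (eps / 3)] in the exponent, leaving
   [eps / 3] for the polynomial in [t]. *)
have [b hb] := INR_archimed _ 3 eps0.
have b0 : (0 < b)%N by case: (b) hb => //=; lra.
have b0R : 0 < INR b by apply: lt_0_INR; lia.
have D0 : 0 < INR d.+1 by apply: lt_0_INR; lia.
have ln2 : 0 < ln 2 by have := ln_lt_2; lra.
(* The factor 8 absorbs the summand 3 in the bound [mk], which comes from rounding up [m] (twice)
   and [k]. *)
pose C := INR (b * 2 ^ b * (4 * d.+1) * 8).
have C0 : 0 < C by apply: lt_0_INR; apply/ltP; rewrite !muln_gt0 b0 expn_gt0.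
have [|T hT] := poly_le_exp b.+1 C0 (c := ln 2 * (eps / 3)).
  by apply: Rmult_lt_0_compat => //; lra.
exists (2 ^ T)%N => n Tn.
have n0 : (0 < n)%N by apply: leq_trans Tn; rewrite expn_gt0.
set t := trunc_log 2 n.
have /andP[tn nt] := trunc_log_bounds (isT : (1 < 2)%N) n0; rewrite -/t in tn nt.
have Tt : (T <= t)%N by rewrite -ltnS -(ltn_exp2l _ _ (isT : (1 < 2)%N)) (leq_ltn_trans Tn).
set m := (t %/ b).+1; set k := (t %/ d.+1).+1.
have nbm : (n <= 2 ^ (b * m))%N.
  by apply: leq_trans (ltnW nt) _; rewrite leq_exp2l // mulnC ltn_ceil.
have nkd : (n <= 2 ^ (k * d.+1))%N.
  by apply: leq_trans (ltnW nt) _; rewrite leq_exp2l // ltn_ceil.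
have := fnpq_colour_bound p8 (isT : (0 < k)%N) nbm nkd (no_tree n).
move=> /leq_trans/(_ (colour_bound_le d t b0)) /INR_le le1.
apply: Rle_trans le1 _; rewrite -/m -/k.
have div_le (q : nat) : (0 < q)%N -> INR (t %/ q) <= INR t / INR q.
  move=> q0; have q0R : 0 < INR q by apply: lt_0_INR; lia.
  apply: (Rmult_le_reg_r (INR q)) => //.
  have -> : INR t / INR q * INR q = INR t by field; lra.
  by rewrite -mult_INR; apply: INR_le; exact: leq_divM.
have mk : INR (2 * m + k) <= INR t * (2 / INR b + 1 / INR d.+1) + 3.
  rewrite plus_INR mult_INR !S_INR /=.
  have := div_le b b0; have := div_le d.+1 isT; rewrite S_INR.
  rewrite /Rdiv; lra.
have b3 : 2 / INR b <= 2 * (eps / 3).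
  apply: (Rmult_le_reg_r (INR b)) => //.
  have -> : 2 / INR b * INR b = 2 by field; lra.
  by lra.
have t0 : 0 <= INR t by exact: pos_INR.
have -> : INR (b * 2 ^ b * (4 * d.+1) * (t + 2) ^ b.+1 * 2 ^ (2 * m + k)) =
          C * (INR t + 2) ^ b.+1 * (exp (ln 2 * INR (2 * m + k)) / 8).
  have -> : exp (ln 2 * INR (2 * m + k)) = 2 ^ (2 * m + k).
    by rewrite Rmult_comm exp_INR_mul exp_ln //; lra.
  rewrite /C !mult_INR !INR_expn plus_INR.
  have -> : INR 8 = 8 by rewrite /=; lra.
  by rewrite -[INR 2]/2; field.
apply: (Rle_trans _ (exp (ln 2 * (eps / 3) * INR t)
                     * exp (ln 2 * (INR t * (2 / INR b + 1 / INR d.+1))))).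
  apply: Rmult_le_compat.
  - apply: Rmult_le_pos; first lra.
    by apply: pow_le; lra.
  - by apply: Rmult_le_pos; [apply: Rlt_le; exact: exp_pos|lra].
  - exact: hT.
  have e8 : 8 = exp (ln 2 * 3).
    have -> : ln 2 * 3 = INR 3 * ln 2 by rewrite /=; lra.
    by rewrite exp_INR_mul exp_ln; lra.
  rewrite {1}e8 /Rdiv -exp_Ropp -exp_plus.
  have [lt|->] : ln 2 * INR (2 * m + k) + - (ln 2 * 3) <=
     ln 2 * (INR t * (2 / INR b + 1 / INR d.+1)).
  + have := Rmult_le_compat_l (ln 2) _ _ (Rlt_le _ _ ln2) mk; lra.
  + by apply: Rlt_le; exact: exp_increasing.
  + exact: Rle_refl.
rewrite -exp_plus.
(* Since [2 ^ t <= n] and the exponent is positive, it suffices to compare at [2 ^ t]. *)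
apply: (Rle_trans _ (Rpower (INR (2 ^ t)) (1 / INR d.+1 + eps))); last first.
  apply: Rle_Rpower_l.
    have : 0 < 1 / INR d.+1 by apply: Rdiv_lt_0_compat; lra.
    by lra.
  split; last exact: INR_le.
  by apply: lt_0_INR; apply/ltP; rewrite expn_gt0.
have -> : INR (2 ^ t) = exp (INR t * ln 2).
  by rewrite INR_expn exp_INR_mul exp_ln //; lra.
rewrite /Rpower ln_exp.
set E1 := (X in exp X <= _); set E2 := (X in _ <= exp X).
have le12 : E1 <= E2.
  have h : 0 <= INR t * ln 2 by apply: Rmult_le_pos; lra.
  have := Rmult_le_compat_l _ _ _ h b3; rewrite /E1 /E2; lra.
case: le12 => [lt|->]; last exact: Rle_refl.
by apply: Rlt_le; exact: exp_increasing.
Qed.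

End Asymptotics.

(* f(n,6,6) <= n^(1/3 + o(1)) and f(n,8,8) <= n^(1/4 + o(1)) as n -> oo:
   for every eps > 0, for all sufficiently large n the bound with
   exponent 1/3 + eps (resp. 1/4 + eps) holds. *)
Theorem theorem1p3 :
  (forall eps : R, (0 < eps)%R ->
     exists N : nat, forall n : nat, (N <= n)%N ->
       (INR (fnpq n 6 6) <= Rpower (INR n) (1/3 + eps))%R) /\
  (forall eps : R, (0 < eps)%R ->
     exists N : nat, forall n : nat, (N <= n)%N ->
       (INR (fnpq n 8 8) <= Rpower (INR n) (1/4 + eps))%R).
Proof.
have I3 : INR 3 = 3%R by rewrite /=; lra.
have I4 : INR 4 = 4%R by rewrite /=; lra.
split=> eps eps0; [rewrite -I3|rewrite -I4]; apply: fnpq_asymptotic => //.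
  by move=> n F g S g_inj S6; exact: mono_tree_size6.
by move=> n F g S g_inj S8; exact: mono_tree_size8.
Qed.
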